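(* Let $r\ge 1$, let $G$ be a regular subgroup of $\mathrm{GA}(r,2)$ and let $\tau: F^r\to F^r$ be the permutation induced by an automorphism of the group $G$. Then the code $S_{\mathcal H,\tau}=\bigcup_{a\in F^r}\mathcal H_a\times\mathcal H_{\tau(a)}$ is a propelinear extended perfect binary code of length $2^{r+1}$.
   Context: $F=\mathrm{GF}(2)$; $F^n$ is the $n$-dimensional vector space over $F$ with the Hamming metric; a code of length $n$ is a set of vectors of $F^n$, whose elements are called codewords. $\mathrm{wt}$ is Hamming weight. ${\bf 0}$ denotes the all-zero vector. A code $C\subseteq F^n$ is perfect if for every $x\in F^n$ there is exactly one $y\in C$ at Hamming distance at most $1$ from $x$. An extended perfect code is a code of length $n+1$ obtained from a perfect code of length $n$ by adding an overall parity check coordinate to all codewords (the position of the parity coordinate is immaterial). $\mathrm{Aut}(F^n)$ is the group of all transformations $(x,\pi)$, $x\in F^n$, $\pi$ a permutation of the coordinate positions, acting by $(x,\pi)(y)=x+\pi(y)$ where $\pi(y)=(y_{\pi^{-1}(1)},\ldots,y_{\pi^{-1}(n)})$. $\mathrm{Aut}(C)$ is the setwise stabilizer of $C$ in $\mathrm{Aut}(F^n)$. A group acting on a set is regular if it acts transitively and its order equals the size of the set. A code $C$ is propelinear if $\mathrm{Aut}(C)$ has a subgroup acting regularly on the codewords of $C$. The coordinates of $F^{2^r}$ are indexed by the vectors of $F^r$; $e_a$ is the vector whose only nonzero coordinate is the one indexed by $a$. $\mathcal H=\{c\in F^{2^r}:\sum_{a:c_a=1}a={\bf 0},\ \mathrm{wt}(c)\equiv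 0 \pmod 2\}$ (an extended Hamming code), and $\mathcal H_a=\mathcal H+e_a+e_{\bf 0}$ for $a\in F^r$. For codes $C,D$, $C\times D=\{x|y: x\in C,\ y\in D\}$, where $x|y$ is concatenation. $\mathrm{GA}(r,2)=\{(a,M):a\in F^r,\ M\in\mathrm{GL}(r,2)\}$ is the general affine group, acting on $F^r$ by $(a,M)(b)=a+Mb$, with composition as group operation. A subgroup $G$ of $\mathrm{GA}(r,2)$ is regular if it acts regularly on the vectors of $F^r$. For such $G$ and $a\in F^r$, $g_a$ denotes the unique element of $G$ mapping ${\bf 0}$ to $a$. The permutation $\tau$ of $F^r$ induced by an automorphism $T$ of the group $G$ is defined by $T(g_a)=g_{\tau(a)}$ for all $a\in F^r$. *)

(* Defs.v *)
From HB Require Import structures.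
From mathcomp Require Import all_boot all_order all_fingroup all_algebra.

Set Implicit Arguments.
Unset Strict Implicit.
Unset Printing Implicit Defensive.

Import GRing.Theory GroupScope.
Local Open Scope ring_scope.

(* A binary word whose coordinate positions are the elements of a finite type
   I: an element of F^n for n = #|I|. *)
Notation word I := {ffun I -> 'F_2}.
Notation code I := {set word I}.
Notation Fvec r := 'cV['F_2]_r.

Section Codes.

Variable I : finType.
Implicit Types (x y : word I) (C : code I) (pi : {perm I}).

Definition wt x : nat := #|[set i | x i != 0]|.

Definition hdist x y : nat := #|[set i | x i != y i]|.

Definition perfect C : Prop :=
  forall x, exists! y, y \in C /\ (hdist x y <= 1)%N.

(* The parity coordinate sits at position None. *)
Definition parity_ext x : word (option I) :=
  [ffun k => if k is Some i then x i else \sum_i x i].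

Definition permute pi y : word I := [ffun i => y (pi^-1%g i)].

(* Aut(F^n), as a set of permutations of F^n.  Since (x, pi) is determined by
   the map y |-> x + pi(y), nothing is lost.  MathComp multiplies permutations
   from left to right, i.e. in the order opposite to composition; this does not
   affect which subsets are subgroups. *)
Definition AutF : {set {perm (word I)}} :=
  [set g : {perm (word I)} |
     [exists x : word I, exists pi : {perm I},
        forall y, g y == x + permute pi y]].

Lemma AutFP (g : {perm (word I)}) :
  reflect (exists (x : word I) (pi : {perm I}),
             forall y, g y = x + permute pi y)
          (g \in AutF).
Proof.
rewrite inE; apply: (iffP existsP) => [[x /existsP[pi /forallP h]]|[x [pi h]]].
  by exists x, pi => y; apply/eqP.
by exists x; apply/existsP; exists pi; apply/forallP => y; rewrite h.
Qed.

Fact AutF_group_set : group_set AutF.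
Proof.
apply/group_setP; split=> [|g h /AutFP[x [pi hg]] /AutFP[y [rho hh]]].
  apply/AutFP; exists 0, 1%g => y; rewrite perm1 add0r.
  by apply/ffunP => i; rewrite ffunE invg1 perm1.
apply/AutFP; exists (y + permute rho x), (pi * rho)%g => z.
rewrite permM hh hg -addrA; congr (_ + _); apply/ffunP => i.
by rewrite !ffunE invMg permM.
Qed.
Canonical AutF_group := Group AutF_group_set.

Definition Aut_code C : {set {perm (word I)}} := 'N_AutF(C | 'P).

End Codes.

Definition regular_on (T : finType) (G : {set {perm T}}) (X : {set T}) : Prop :=
  [transitive G, on X | 'P] /\ #|G| = #|X|.

Definition propelinear (I : finType) (C : code I) : Prop :=
  exists G : {group {perm (word I)}}, G \subset Aut_code C /\ regular_on G C.

(* The bijection f identifies the coordinate positions of C with those of the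
   extended words, so that the parity coordinate may be at any position. *)
Definition extended_perfect (J : finType) (C : code J) : Prop :=
  exists (n : nat) (P : code 'I_n) (f : J -> option 'I_n),
    [/\ perfect P, bijective f &
        C = [set [ffun j => parity_ext x (f j)] | x in P]].

Definition concat (I J : finType) (x : word I) (y : word J) :
    word (I + J)%type :=
  [ffun k => match k with inl i => x i | inr j => y j end].

Definition code_prod (I J : finType) (C : code I) (D : code J) :
    code (I + J)%type :=
  [set concat x y | x in C, y in D].

Section Affine.

Variable r : nat.
Implicit Types (a b : Fvec r) (M : 'M['F_2]_r).

Definition unit_word a : word (Fvec r) := [ffun b => (b == a)%:R].

Definition ext_Hamming : code (Fvec r) :=
  [set c : word (Fvec r) | (\sum_(a | c a == 1) a == 0) && ~~ odd (wt c)].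

Definition ext_Hamming_shift a : code (Fvec r) :=
  [set c + unit_word a + unit_word 0 | c : word (Fvec r) in ext_Hamming].

Definition S_code (tau : Fvec r -> Fvec r) : code (Fvec r + Fvec r)%type :=
  \bigcup_a code_prod (ext_Hamming_shift a) (ext_Hamming_shift (tau a)).

(* GA(r,2), as a set of permutations of F^r; (a, M) is determined by the map
   b |-> a + M b.  The left-to-right product of permutations makes this the
   opposite of the group under composition, which has the same subgroups with
   the same automorphisms. *)
Definition GA : {set {perm (Fvec r)}} :=
  [set g : {perm (Fvec r)} | [exists a : Fvec r, exists M : 'M['F_2]_r,
     (M \in unitmx) && [forall b, g b == a + M *m b]]].

Lemma GAP (g : {perm (Fvec r)}) :
  reflect (exists (a : Fvec r) (M : 'M['F_2]_r),
             M \in unitmx /\ forall b, g b = a + M *m b)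
          (g \in GA).
Proof.
rewrite inE; apply: (iffP existsP).
  case=> a /existsP[M /andP[uM /forallP h]].
  by exists a, M; split=> // b; apply/eqP.
case=> a [M [uM h]]; exists a; apply/existsP; exists M; rewrite uM.
by apply/forallP => b; rewrite h.
Qed.

Fact GA_group_set : group_set GA.
Proof.
apply/group_setP; split=> [|g h /GAP[a [M [uM hg]]] /GAP[b [N [uN hh]]]].
  apply/GAP; exists 0, 1%:M; split=> [|b]; first exact: unitmx1.
  by rewrite perm1 add0r mul1mx.
apply/GAP; exists (b + N *m a), (N *m M); split=> [|c].
  by rewrite unitmx_mul uN.
by rewrite permM hh hg mulmxDr mulmxA addrA.
Qed.
Canonical GA_group := Group GA_group_set.

(* For a regular subgroup G the element g_a exists and is unique; the default
   value 1 is then never used. *)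
Definition g_ (G : {set {perm (Fvec r)}}) a : {perm (Fvec r)} :=
  odflt 1%g [pick g in G | g 0 == a].

Definition induced_perm (G : {set {perm (Fvec r)}})
    (T : {perm {perm (Fvec r)}}) (tau : {perm (Fvec r)}) : Prop :=
  forall a, T (g_ G a) = g_ G (tau a).

End Affine.

(* Main.v *)
Require Import Defs.
From HB Require Import structures.
From mathcomp Require Import all_boot all_order all_fingroup all_algebra.

Set Implicit Arguments.
Unset Strict Implicit.
Unset Printing Implicit Defensive.

(* Write s(x) for the sum of the vectors indexing the nonzero coordinates of x.
   Then x|y is in S iff x and y have even weight and tau(s(x)) = s(y).
   If x|y has odd weight, exactly one of x, y is odd, and the condition
   determines the unique coordinate in that half whose flip gives a word of S;
   so every word of odd weight has exactly one neighbour in S, and puncturing S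
   gives a perfect code.
   For z = x|y in S with s(x) = a, let phi_z map u|v to
   x + g_a(u) | y + g_(tau a)(v).  On words u of even weight,
   s(x + g_a(u)) = g_a(s(u)), and tau (g_a b) = g_(tau a) (tau b) because T is a
   homomorphism.  Hence phi_z preserves S and phi_z o phi_z' = phi_(phi_z z'),
   so the maps phi_z form a group, regular on S since phi_z 0 = z. *)

Import GRing.Theory GroupScope.
Local Open Scope ring_scope.

Lemma F2_case (a : 'F_2) : a = 0 \/ a = 1.
Proof. by case: a => -[|[|//]] lt_a2; [left|right]; apply: val_inj. Qed.

Lemma F2_addrr (V : lmodType 'F_2) (v : V) : v + v = 0.
Proof.
have two0 : 2%:R = 0 :> 'F_2 by apply: val_inj.
by rewrite -mulr2n -scaler_nat two0 scale0r.
Qed.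

(** * Parity of a word as an element of ['F_2], and coordinate permutations *)

Section Parity.

Variable I : finType.
Implicit Types (x y : word I) (i : I).

Definition par x : 'F_2 := \sum_i x i.

Definition flip i : word I := [ffun j => (j == i)%:R].

Lemma parD x y : par (x + y) = par x + par y.
Proof. by rewrite -big_split; apply: eq_bigr => i _; rewrite ffunE. Qed.

Lemma par0 : par 0 = 0.
Proof. by apply: big1 => i _; rewrite ffunE. Qed.

Lemma par_flip i : par (flip i) = 1.
Proof.
rewrite /par (bigD1 i) //= ffunE eqxx big1 ?addr0 // => j /negPf ne_ji.
by rewrite ffunE ne_ji.
Qed.

Lemma par_permute (p : {perm I}) x : par (permute p x) = par x.
Proof.
rewrite /par (reindex_inj (@perm_inj _ p)).
by apply: eq_bigr => i _; rewrite ffunE permK.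
Qed.

Lemma par_wt x : (par x == 0) = ~~ odd (wt x).
Proof.
have -> : par x = (wt x)%:R.
  rewrite /wt -sum1_card natr_sum big_mkcond /=; apply: eq_bigr => i _.
  by rewrite inE; case: (F2_case (x i)) => ->.
by rewrite -(dvdn_pcharf (pchar_Fp (isT : prime 2))) dvdn2.
Qed.

Lemma permute0 (p : {perm I}) : permute p 0 = 0.
Proof. by apply/ffunP => i; rewrite !ffunE. Qed.

Lemma permuteD (p : {perm I}) x y :
  permute p (x + y) = permute p x + permute p y.
Proof. by apply/ffunP => i; rewrite !ffunE. Qed.

Lemma permute1 x : permute 1%g x = x.
Proof. by apply/ffunP => i; rewrite ffunE invg1 perm1. Qed.

Lemma permuteM (p q : {perm I}) x :
  permute (p * q)%g x = permute q (permute p x).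
Proof. by apply/ffunP => i; rewrite !ffunE invMg permM. Qed.

Lemma permute_inj (p : {perm I}) : injective (permute p).
Proof.
apply: (can_inj (g := permute p^-1)) => x.
by rewrite -permuteM mulgV permute1.
Qed.

End Parity.

(** * A criterion for extended perfect codes in terms of neighbours of odd words *)

Section ExtendedPerfect.

Variable n : nat.
Implicit Types (x y : word 'I_n).

(* The words of weight at most 1, with [None] standing for the zero word. *)
Definition oflip (k : option 'I_n) : word 'I_n :=
  [ffun i => (k == Some i)%:R].

Lemma hdist_le1P x y :
  reflect (exists k, y = x + oflip k) (hdist x y <= 1)%N.
Proof.
apply: (iffP idP) => [|[k ->]].
  rewrite leq_eqVlt ltnS leqn0 cards_eq0 => /orP[/cards1P[i]|/eqP] /setP eqD.
    exists (Some i); apply/ffunP => j; rewrite !ffunE.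
    have := eqD j; rewrite !inE eq_sym -[Some i == _]/(i == j) [i == j]eq_sym.
    case: (j == i) => [ne_yx|/negbFE/eqP->]; last by rewrite addr0.
    by move: ne_yx; case: (F2_case (x j)) => ->; case: (F2_case (y j)) => ->;
      rewrite ?eqxx // => _; apply: val_inj.
  exists None; apply/ffunP => j; rewrite !ffunE addr0.
  by have := eqD j; rewrite !inE => /negbFE/eqP.
case: k => [i|]; last first.
  rewrite /hdist (_ : [set _ | _] = set0) ?cards0 //; apply/setP => j.
  by rewrite !inE !ffunE addr0 eqxx.
apply: (@leq_trans #|[set i]|); last by rewrite cards1.
apply/subset_leq_card/subsetP => j; rewrite !inE !ffunE.
rewrite -[Some i == _]/(i == j) [i == j]eq_sym; case: (j == i) => //.
by rewrite addr0 eqxx.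
Qed.

Variables (J : finType) (f : J -> option 'I_n) (g : option 'I_n -> J).
Hypotheses (fK : cancel f g) (gK : cancel g f).

Definition pext x : word J := [ffun j => parity_ext x (f j)].

Lemma par_split (c : word J) :
  par c = c (g None) + \sum_i c (g (Some i)).
Proof.
rewrite /par (reindex g) /=; last by exists f => ? _.
rewrite (bigD1 None) //=; congr (_ + _).
rewrite (reindex_omap Some id) /=; last by case.
by apply: eq_bigl => i; rewrite eqxx.
Qed.

(** Once the other coordinates are known, the overall parity determines the one at [g None]. *)
Lemma par_inj (c d : word J) :
    par c = par d -> (forall i, c (g (Some i)) = d (g (Some i))) -> c = d.
Proof.
rewrite !par_split => eq_par eq_cd; apply/ffunP => j; rewrite -(fK j).
case: (f j) => [i|]; first exact: eq_cd.
by move: eq_par; rewrite (eq_bigr _ (fun i _ => eq_cd i)) => /addIr.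
Qed.

Lemma pext_Some x i : pext x (g (Some i)) = x i.
Proof. by rewrite ffunE gK ffunE. Qed.

Lemma par_pext x : par (pext x) = 0.
Proof.
rewrite par_split ffunE gK ffunE (eq_bigr _ (fun i _ => pext_Some x i)).
by case: (F2_case (\sum_i x i)) => ->; rewrite ?addr0 //; apply: val_inj.
Qed.

(** Flipping a coordinate of [x] also flips its parity bit; for [k = None] the two flips on the
    right cancel. *)
Lemma pext_oflip x k :
  pext (x + oflip k) = pext x + flip (g None) + flip (g k).
Proof.
apply: par_inj => [|i].
  by rewrite !parD !par_pext !par_flip; apply: val_inj.
rewrite [RHS]ffunE [in RHS]ffunE !pext_Some !ffunE !(can_eq gK) addr0.
by rewrite eq_sym.
Qed.

(** The ball of radius 1 around [x] corresponds to the neighbours of the odd word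
    [pext x + flip (g None)]: flipping [g k] yields the extension of [x + oflip k]. *)
Lemma pext_perfect (C : code J) :
    (forall w, par w = 1 -> exists! j, w + flip j \in C) ->
  perfect [set x | pext x \in C].
Proof.
move=> hC x.
have [|j [jC j_uniq]] := hC (pext x + flip (g None)).
  by rewrite parD par_pext par_flip add0r.
exists (x + oflip (f j)); split=> [|y [yC /hdist_le1P[k def_y]]].
  by rewrite inE pext_oflip fK; split=> //; apply/hdist_le1P; exists (f j).
by move: yC; rewrite def_y inE pext_oflip => /j_uniq ->; rewrite gK.
Qed.

Lemma pext_image (C : code J) :
    (forall c, c \in C -> par c = 0) ->
  C = [set pext x | x in [set x | pext x \in C]].
Proof.
move=> C_even; apply/setP => c; apply/idP/imsetP => [cC|[x]]; last first.
  by rewrite inE => xC ->.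
have def_c : c = pext [ffun i => c (g (Some i))].
  apply: par_inj => [|i]; first by rewrite par_pext C_even.
  by rewrite pext_Some ffunE.
by exists [ffun i => c (g (Some i))]; rewrite // inE -def_c.
Qed.

End ExtendedPerfect.

Lemma extended_perfect_crit (J : finType) (C : code J) :
    (0 < #|J|)%N -> (forall c, c \in C -> par c = 0) ->
    (forall w, par w = 1 -> exists! j, w + flip j \in C) ->
  extended_perfect C.
Proof.
(* One position is kept for parity, so the punctured length is the predecessor of [#|J|]. *)
case card_J : #|J| => [//|n] _ C_even hC.
have card_o : #|{: option 'I_n}| = #|J| by rewrite card_option card_ord card_J.
(* Any bijection serves here, since the criterion is symmetric in the positions. *)
pose f (j : J) : option 'I_n := enum_val (cast_ord (esym card_o) (enum_rank j)).
pose g (k : option 'I_n) : J := enum_val (cast_ord card_o (enum_rank k)).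
have fK : cancel f g by move=> j; rewrite /f /g enum_valK cast_ordKV enum_rankK.
have gK : cancel g f by move=> k; rewrite /f /g enum_valK cast_ordK enum_rankK.
exists n, [set x | pext f x \in C], f; split; first exact: pext_perfect fK gK _ hC.
  by exists g.
exact: pext_image fK gK _ C_even.
Qed.

(** * Syndromes and the cosets of the extended Hamming code *)

Section Syndrome.

Variable r : nat.
Implicit Types (x y : word (Fvec r)) (a b : Fvec r).

(** This is the syndrome for the check matrix whose columns are all vectors of [Fvec r]. *)
Definition synd x : Fvec r := \sum_b x b *: b.

Lemma syndD x y : synd (x + y) = synd x + synd y.
Proof. by rewrite -big_split; apply: eq_bigr => b _; rewrite ffunE scalerDl. Qed.

Lemma synd0 : synd 0 = 0.
Proof. by apply: big1 => b _; rewrite ffunE scale0r. Qed.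

Lemma synd_flip a : synd (flip a) = a.
Proof.
rewrite /synd (bigD1 a) //= ffunE eqxx scale1r big1 ?addr0 // => b /negPf ne_ba.
by rewrite ffunE ne_ba scale0r.
Qed.

Lemma mem_ext_Hamming x :
  (x \in ext_Hamming r) = (par x == 0) && (synd x == 0).
Proof.
rewrite inE par_wt andbC; congr (_ && (_ == _)).
rewrite big_mkcond; apply: eq_bigr => b _.
by case: (F2_case (x b)) => ->; rewrite ?scale0r ?scale1r.
Qed.

(** Adding [flip a + flip 0] preserves parity and adds [a] to the syndrome. *)
Lemma mem_ext_Hamming_shift a x :
  (x \in ext_Hamming_shift a) = (par x == 0) && (synd x == a).
Proof.
apply/imsetP/idP => [[c]|/andP[/eqP par_x /eqP synd_x]].
  rewrite mem_ext_Hamming => /andP[/eqP par_c /eqP synd_c] ->.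
  by rewrite !parD !syndD !par_flip !synd_flip par_c synd_c !add0r addr0 eqxx.
(* In characteristic 2 the shift is its own inverse. *)
exists (x + flip a + flip 0).
  rewrite mem_ext_Hamming !parD !syndD !par_flip !synd_flip par_x synd_x.
  by rewrite addr0 F2_addrr add0r eqxx.
apply/ffunP => b; rewrite !ffunE.
by case: (F2_case (x b)) => ->; case: (_ == _); case: (_ == _); apply: val_inj.
Qed.

(* Even weight makes the translation part of an affine map cancel. *)
Lemma synd_permute (p : {perm (Fvec r)}) x :
  p \in GA r -> par x = 0 -> synd (permute p x) = p (synd x) - p 0.
Proof.
case/GAP=> a [M [_ pE]] par_x; rewrite !pE mulmx0 addr0 addrAC subrr add0r.
rewrite /synd (reindex_inj (@perm_inj _ p)).
under eq_bigr => b _ do rewrite ffunE permK pE scalerDr scalemxAr.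
by rewrite big_split -scaler_suml -mulmx_sumr /= [X in X *: _]par_x scale0r add0r.
Qed.

End Syndrome.

(** * Words on a disjoint union of two coordinate sets *)

Section Halves.

Variables A B : finType.
Implicit Types (z u : word (A + B)%type).

Definition lft z : word A := [ffun i => z (inl i)].
Definition rgt z : word B := [ffun j => z (inr j)].

Lemma lftD z u : lft (z + u) = lft z + lft u.
Proof. by apply/ffunP => i; rewrite !ffunE. Qed.

Lemma rgtD z u : rgt (z + u) = rgt z + rgt u.
Proof. by apply/ffunP => i; rewrite !ffunE. Qed.

Lemma lft0 : lft 0 = 0.
Proof. by apply/ffunP => i; rewrite !ffunE. Qed.

Lemma rgt0 : rgt 0 = 0.
Proof. by apply/ffunP => i; rewrite !ffunE. Qed.

Lemma lft_flip_inl i : lft (flip (inl i)) = flip i.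
Proof. by apply/ffunP => k; rewrite !ffunE. Qed.

Lemma lft_flip_inr j : lft (flip (inr j)) = 0.
Proof. by apply/ffunP => k; rewrite !ffunE. Qed.

Lemma rgt_flip_inl i : rgt (flip (inl i)) = 0.
Proof. by apply/ffunP => k; rewrite !ffunE. Qed.

Lemma rgt_flip_inr j : rgt (flip (inr j)) = flip j.
Proof. by apply/ffunP => k; rewrite !ffunE. Qed.

Lemma lft_concat (x : word A) (y : word B) : lft (concat x y) = x.
Proof. by apply/ffunP => i; rewrite !ffunE. Qed.

Lemma rgt_concat (x : word A) (y : word B) : rgt (concat x y) = y.
Proof. by apply/ffunP => i; rewrite !ffunE. Qed.

Lemma concatK z : concat (lft z) (rgt z) = z.
Proof. by apply/ffunP => -[i|j]; rewrite !ffunE. Qed.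

Lemma par_halves z : par z = par (lft z) + par (rgt z).
Proof.
rewrite /par big_sumType.
by congr (_ + _); apply: eq_bigr => i _; rewrite ffunE.
Qed.

Lemma mem_code_prod (C : code A) (D : code B) z :
  (z \in code_prod C D) = (lft z \in C) && (rgt z \in D).
Proof.
apply/imset2P/andP => [[x y xC yD ->]|[zC zD]].
  by rewrite lft_concat rgt_concat.
by exists (lft z) (rgt z); rewrite ?concatK.
Qed.

Definition sum_map (p : A -> A) (q : B -> B) (k : A + B) : A + B :=
  match k with inl i => inl (p i) | inr j => inr (q j) end.

Lemma sum_map_inj (p : {perm A}) (q : {perm B}) : injective (sum_map p q).
Proof. by move=> [i|j] [i'|j'] // [/perm_inj->]. Qed.

Definition sum_perm p q : {perm A + B} := perm (@sum_map_inj p q).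

Lemma lft_permute p q z : lft (permute (sum_perm p q) z) = permute p (lft z).
Proof.
(* Applying [sum_perm p q] to both positions avoids computing its inverse. *)
apply/ffunP => i; rewrite !ffunE; congr (z _); apply: (@perm_inj _ (sum_perm p q)).
by rewrite permKV permE /= permKV.
Qed.

Lemma rgt_permute p q z : rgt (permute (sum_perm p q) z) = permute q (rgt z).
Proof.
apply/ffunP => j; rewrite !ffunE; congr (z _); apply: (@perm_inj _ (sum_perm p q)).
by rewrite permKV permE /= permKV.
Qed.

Lemma sum_perm1 : sum_perm 1 1 = 1%g.
Proof. by apply/permP => -[i|j]; rewrite permE /= !perm1. Qed.

Lemma sum_permM p q p' q' :
  sum_perm (p * p') (q * q') = (sum_perm p q * sum_perm p' q')%g.
Proof. by apply/permP => -[i|j]; rewrite permM !permE /= permM. Qed.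

End Halves.

(** * Membership in the code and unique neighbours of odd words *)

Section SCode.

Variables (r : nat) (tau : {perm (Fvec r)}).
Implicit Types z : word (Fvec r + Fvec r)%type.

Lemma mem_S_code z :
  (z \in S_code tau) = [&& par (lft z) == 0, par (rgt z) == 0 &
                           synd (rgt z) == tau (synd (lft z))].
Proof.
apply/bigcupP/and3P => [[a _]|[par_l par_r synd_z]].
  rewrite mem_code_prod !mem_ext_Hamming_shift.
  by case/andP=> /andP[-> /eqP->] /andP[-> ->].
exists (synd (lft z)) => //.
by rewrite mem_code_prod !mem_ext_Hamming_shift par_l par_r synd_z eqxx.
Qed.

Lemma S_code_even z : z \in S_code tau -> par z = 0.
Proof.
by rewrite mem_S_code par_halves => /and3P[/eqP-> /eqP-> _]; rewrite addr0.
Qed.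

Lemma S_code_neighbour z :
  par z = 1 -> exists! k, z + flip k \in S_code tau.
Proof.
rewrite par_halves => par_z.
have mem_inl a : (z + flip (inl a) \in S_code tau) =
    [&& par (lft z) + 1 == 0, par (rgt z) == 0 &
        synd (rgt z) == tau (synd (lft z) + a)].
  by rewrite mem_S_code lftD rgtD lft_flip_inl rgt_flip_inl addr0 parD par_flip
             syndD synd_flip.
have mem_inr a : (z + flip (inr a) \in S_code tau) =
    [&& par (lft z) == 0, par (rgt z) + 1 == 0 &
        synd (rgt z) + a == tau (synd (lft z))].
  by rewrite mem_S_code lftD rgtD lft_flip_inr rgt_flip_inr addr0 parD par_flip
             syndD synd_flip.
case: (F2_case (par (lft z))) (F2_case (par (rgt z))) par_z mem_inl mem_inr
  => -> [] -> // _ mem_inl mem_inr.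
  (* The right half is odd: the flip must move its syndrome to [tau (synd (lft z))]. *)
  exists (inr (tau (synd (lft z)) - synd (rgt z))); split=> [|[a|a]].
  - by rewrite mem_inr [synd _ + _]addrC subrK !eqxx.
  - by rewrite mem_inl.
  by rewrite mem_inr => /and3P[_ _ /eqP <-]; rewrite addrAC subrr add0r.
(* The left half is odd: its new syndrome must be the preimage of [synd (rgt z)] under [tau], which
   exists and is unique as [tau] is a permutation. *)
exists (inl (tau^-1%g (synd (rgt z)) - synd (lft z))); split=> [|[a|a]].
- by rewrite mem_inl [synd _ + _]addrC subrK permKV !eqxx.
- by rewrite mem_inl => /and3P[_ _ /eqP->]; rewrite permK addrAC subrr add0r.
by rewrite mem_inr.
Qed.

End SCode.

(** * The regular group of automorphisms of the code *)

Section Propelinear.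

Variables (r : nat) (G : {group {perm (Fvec r)}}).
Hypotheses (hGA : G \subset GA r) (hreg : regular_on G [set: Fvec r]).

(** Transitivity ensures that the choice in [g_] never falls back on its default. *)
Lemma g_spec a : g_ G a \in G /\ g_ G a 0 = a.
Proof.
case: hreg => trG _; rewrite /g_.
case: pickP => [h /andP[hG /eqP]|no_h] //=.
have [h hG def_a] := atransP2 trG (in_setT 0) (in_setT a).
by have := no_h h; rewrite /= hG def_a eqxx.
Qed.

Lemma g_in a : g_ G a \in G. Proof. by case: (g_spec a). Qed.

Lemma g_zero a : g_ G a 0 = a. Proof. by case: (g_spec a). Qed.

Lemma g_uniq h : h \in G -> g_ G (h 0) = h.
Proof.
(* Evaluation at 0 maps [G] onto a set of the same size, hence injectively. *)
have inj0 : {in G &, injective (fun h : {perm (Fvec r)} => h 0)}.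
  apply/imset_injP; case: hreg => _ ->; apply/eqP/eq_card => a; rewrite in_setT.
  by apply/imsetP; exists (g_ G a); [exact: g_in | rewrite g_zero].
by move=> hG; apply: inj0; rewrite ?g_zero ?g_in.
Qed.

Lemma g0 : g_ G 0 = 1%g.
Proof. by rewrite -[X in g_ G X](perm1 (0 : Fvec r)) g_uniq. Qed.

(** The product acts from left to right, so it sends 0 first to [a], then to [g_ G b a]. *)
Lemma gM a b : (g_ G a * g_ G b)%g = g_ G (g_ G b a).
Proof. by rewrite -(g_uniq (groupM (g_in a) (g_in b))) permM g_zero. Qed.

(** The syndrome of the permuted word lacks the translation part [g_ G a 0 = a]; adding [x] restores
    it. *)
Lemma synd_affine a (x u : word (Fvec r)) :
  synd x = a -> par u = 0 -> synd (x + permute (g_ G a) u) = g_ G a (synd u).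
Proof.
move=> synd_x par_u; rewrite syndD synd_permute ?(subsetP hGA) ?g_in //.
by rewrite synd_x g_zero addrC subrK.
Qed.

Variables (T : {perm {perm (Fvec r)}}) (tau : {perm (Fvec r)}).
Hypotheses (hT : T \in Aut G) (htau : induced_perm G T tau).

Lemma tau_g a b : tau (g_ G a b) = g_ G (tau a) (tau b).
Proof.
(* Both sides equal the image under [T] of [g_ G b * g_ G a]; evaluation at 0 then removes the outer
   [g_ G]. *)
have eqg : g_ G (tau (g_ G a b)) = g_ G (g_ G (tau a) (tau b)).
  rewrite -htau -gM -[in RHS]gM -!htau -!(autmE hT).
  by rewrite morphM ?g_in.
by have := congr1 (fun h : {perm (Fvec r)} => h 0) eqg; rewrite !g_zero.
Qed.

Lemma tau0 : tau 0 = 0.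
Proof.
have := htau 0; rewrite g0 -(autmE hT) morph1.
by move/(congr1 (fun h : {perm (Fvec r)} => h 0)); rewrite g_zero perm1.
Qed.

Implicit Types z u : word (Fvec r + Fvec r)%type.

Definition zperm z : {perm (Fvec r + Fvec r)} :=
  sum_perm (g_ G (synd (lft z))) (g_ G (synd (rgt z))).

Lemma phi_inj z : injective (fun u => z + permute (zperm z) u).
Proof. by move=> u v /addrI/permute_inj. Qed.

Definition phi z : {perm (word (Fvec r + Fvec r)%type)} := perm (@phi_inj z).

Lemma phiE z u : phi z u = z + permute (zperm z) u.
Proof. exact: permE. Qed.

Lemma phi_zero z : phi z 0 = z.
Proof. by rewrite phiE permute0 addr0. Qed.

Lemma S_code0 : 0 \in S_code tau.
Proof. by rewrite mem_S_code lft0 rgt0 !par0 !synd0 tau0 !eqxx. Qed.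

Lemma phi_spec z u : z \in S_code tau -> u \in S_code tau ->
  [/\ par (lft (phi z u)) = 0, par (rgt (phi z u)) = 0,
      synd (lft (phi z u)) = g_ G (synd (lft z)) (synd (lft u)) &
      synd (rgt (phi z u)) = g_ G (synd (rgt z)) (synd (rgt u))].
Proof.
rewrite !mem_S_code => /and3P[/eqP zl /eqP zr _] /and3P[/eqP ul /eqP ur _].
rewrite phiE lftD rgtD lft_permute rgt_permute.
by split; rewrite ?synd_affine // parD par_permute ?zl ?zr ?ul ?ur addr0.
Qed.

Lemma phi_S z u : z \in S_code tau -> u \in S_code tau -> phi z u \in S_code tau.
Proof.
move=> zS uS; have [par_l par_r syn_l syn_r] := phi_spec zS uS.
rewrite mem_S_code par_l par_r syn_l syn_r !eqxx tau_g.
move: zS uS; rewrite !mem_S_code.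
by move=> /and3P[_ _ /eqP<-] /and3P[_ _ /eqP<-] /=.
Qed.

(** By [phi_spec] and [gM], the coordinate permutation attached to [phi u z] is [zperm z * zperm u].
    The roles of [z] and [u] are swapped on the right because permutations multiply from left to
    right. *)
Lemma phiM z u : z \in S_code tau -> u \in S_code tau ->
  (phi z * phi u)%g = phi (phi u z).
Proof.
move=> zS uS; apply/permP => v; have [_ _ syn_l syn_r] := phi_spec uS zS.
rewrite permM [RHS]phiE /zperm syn_l syn_r -!gM sum_permM permuteM !phiE.
by rewrite permuteD addrA.
Qed.

Lemma phi0 : phi 0 = 1%g.
Proof.
apply/permP => v.
by rewrite phiE /zperm lft0 rgt0 synd0 g0 sum_perm1 permute1 add0r perm1.
Qed.

Definition phis : {set {perm (word (Fvec r + Fvec r)%type)}} := phi @: S_code tau.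

Lemma phis_group_set : group_set phis.
Proof.
apply/group_setP; split; first by rewrite -phi0 imset_f ?S_code0.
move=> _ _ /imsetP[z zS ->] /imsetP[u uS ->].
by rewrite phiM // imset_f ?phi_S.
Qed.

Lemma phis_Aut : phis \subset Aut_code (S_code tau).
Proof.
apply/subsetP => _ /imsetP[z zS ->]; rewrite inE; apply/andP; split.
  by apply/AutFP; exists z, (zperm z) => u; rewrite phiE.
by rewrite !inE; apply/subsetP => u uS; rewrite inE; apply: phi_S.
Qed.

Lemma phis_regular : regular_on phis (S_code tau).
Proof.
(* Evaluation at the zero word recovers [z] from [phi z], which gives the order; the orbit of that
   word, itself in the code, gives transitivity. *)
split; last by rewrite card_imset // => z u /permP/(_ 0); rewrite !phi_zero.
apply/imsetP; exists 0; first exact: S_code0.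
apply/setP => z; apply/idP/imsetP => [zS|[_ /imsetP[u uS ->] ->]].
  by exists (phi z); rewrite ?imset_f //= apermE phi_zero.
by rewrite /= apermE phi_zero.
Qed.

Lemma S_code_propelinear : propelinear (S_code tau).
Proof.
exists (Group phis_group_set).
by split; [exact: phis_Aut | exact: phis_regular].
Qed.

End Propelinear.

Theorem theorem1 (r : nat) (hr : (1 <= r)%N)
    (G : {group {perm (Fvec r)}})
    (hGA : G \subset GA r)
    (hreg : regular_on G [set: Fvec r])
    (T : {perm {perm (Fvec r)}}) (hT : T \in Aut G)
    (tau : {perm (Fvec r)}) (htau : induced_perm G T tau) :
  [/\ #|{: Fvec r + Fvec r}| = (2 ^ r.+1)%N,
      extended_perfect (S_code tau)
    & propelinear (S_code tau)].
Proof.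
have card_J : #|{: Fvec r + Fvec r}| = (2 ^ r.+1)%N.
  by rewrite card_sum card_mx card_ord muln1 addnn -mul2n -expnS.
split; first exact: card_J; last first.
  exact: (S_code_propelinear hGA hreg hT htau).
apply: extended_perfect_crit; first by rewrite card_J expn_gt0.
  exact: S_code_even.
exact: S_code_neighbour.
Qed.
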